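(* Let $\widehat{a}=a+\varepsilon b$, $\widehat{c}=c+\varepsilon d$, $\widehat{e}=e+\varepsilon f$ and $\widehat{g}=g+\varepsilon h$ be dual numbers ($a,b,c,d,e,f,g,h\in\mathbb{R}$). Assume, in each item below, that the real part of every argument of $\beta_d$ and $\Gamma_d$ appearing there is not in $\{0,-1,-2,\dots\}$, and in item 1 also that $a+c\neq0$. Then: 1. $\beta_d(\widehat{a},\widehat{c}+1)=\dfrac{\widehat{c}}{\widehat{a}}\,\beta_d(\widehat{a}+1,\widehat{c})=\dfrac{\widehat{c}}{\widehat{a}+\widehat{c}}\,\beta_d(\widehat{a},\widehat{c})$. 2. $\beta_d(\widehat{a},\widehat{c})\,\beta_d(\widehat{a}+\widehat{c},\widehat{e})=\beta_d(\widehat{c},\widehat{e})\,\beta_d(\widehat{c}+\widehat{e},\widehat{a})=\beta_d(\widehat{e},\widehat{a})\,\beta_d(\widehat{a}+\widehat{e},\widehat{c})$. 3. $\beta_d(\widehat{a},\widehat{c})\,\beta_d(\widehat{a}+\widehat{c},\widehat{e})\,\beta_d(\widehat{a}+\widehat{c}+\widehat{e},\widehat{g})=\dfrac{\Gamma_d(\widehat{a})\,\Gamma_d(\widehat{c})\,\Gamma_d(\widehat{e})\,\Gamma_d(\widehat{g})}{\Gamma_d(\widehat{a}+\widehat{c}+\widehat{e}+\widehat{g})}$.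
   Context: Dual numbers are $\widehat{x}=x_1+\varepsilon x_2$, $x_1,x_2\in\mathbb{R}$, $\varepsilon^2=0$, forming the commutative ring $\mathbb{R}[\varepsilon]/(\varepsilon^2)$; $x_1$ is the real part, and division by $\widehat{x}$ is possible iff $x_1\ne0$. For real $t>0$, $t^{a+\varepsilon b}=t^a(1+\varepsilon b\log t)$. The dual gamma function is $\Gamma_d(a+\varepsilon b)=\Gamma(a)+\varepsilon b\,\Gamma'(a)$ for $a\ne0,-1,-2,\dots$ (for $a>0$ this equals $\int_0^\infty e^{-t}t^{\widehat{a}-1}dt$). The dual beta function is $\beta_d(\widehat{a},\widehat{c})=\int_0^1 t^{\widehat{a}-1}(1-t)^{\widehat{c}-1}\,dt$ for $a,c>0$ (integrating real and dual parts), which equals $\beta(a,c)+\varepsilon b\,\frac{\partial}{\partial a}\beta(a,c)+\varepsilon d\,\frac{\partial}{\partial c}\beta(a,c)$; for other real $a,c\notin\{0,-1,-2,\dots\}$ it is defined by this last formula, with $\beta(a,c)=\Gamma(a)\Gamma(c)\cdot\frac{1}{\Gamma}(a+c)$, where $1/\Gamma$ is the entire reciprocal gamma function (equal to $0$ at $0,-1,-2,\dots$). *)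

(* Defs.v *)
From HB Require Import structures.
From mathcomp Require Import all_boot all_order all_algebra.
From mathcomp Require Import all_classical all_reals all_analysis.
From mathcomp Require Import ring.
Set Implicit Arguments.
Unset Strict Implicit.
Unset Printing Implicit Defensive.
Import Order.TTheory GRing.Theory Num.Theory.
Import numFieldNormedType.Exports.
Local Open Scope ring_scope.
Local Open Scope classical_set_scope.

(* [Dual x y] is the dual number x + eps y, with eps ^+ 2 = 0. *)
Record dual (R : Type) := Dual { dre : R; deps : R }.

Section DualRing.
Variable R : fieldType.
Implicit Types x y z : dual R.

Definition pair_of_dual x : R * R := (dre x, deps x).
Definition dual_of_pair (p : R * R) : dual R := Dual p.1 p.2.
Lemma pair_of_dualK : cancel pair_of_dual dual_of_pair.
Proof. by case. Qed.

HB.instance Definition _ := Choice.copy (dual R) (can_type pair_of_dualK).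

Definition dual_add x y := Dual (dre x + dre y) (deps x + deps y).
Definition dual_opp x := Dual (- dre x) (- deps x).
Definition dual_mul x y :=
  Dual (dre x * dre y) (dre x * deps y + deps x * dre y).

Lemma dual_addA : associative dual_add.
Proof. by move=> [? ?] [? ?] [? ?]; congr Dual; rewrite /= addrA. Qed.
Lemma dual_addC : commutative dual_add.
Proof. by move=> [? ?] [? ?]; congr Dual; rewrite /= addrC. Qed.
Lemma dual_add0 : left_id (Dual 0 0) dual_add.
Proof. by move=> [? ?]; rewrite /dual_add /= !add0r. Qed.
Lemma dual_addN : left_inverse (Dual 0 0) dual_opp dual_add.
Proof. by move=> [? ?]; rewrite /dual_add /= !addNr. Qed.

HB.instance Definition _ :=
  GRing.isZmodule.Build (dual R) dual_addA dual_addC dual_add0 dual_addN.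

Lemma dual_mulA : associative dual_mul.
Proof. by move=> [? ?] [? ?] [? ?]; congr Dual => /=; ring. Qed.
Lemma dual_mulC : commutative dual_mul.
Proof. by move=> [? ?] [? ?]; congr Dual => /=; ring. Qed.
Lemma dual_mul1 : left_id (Dual 1 0) dual_mul.
Proof. by move=> [? ?]; rewrite /dual_mul /= !mul1r mul0r addr0. Qed.
Lemma dual_mulDl : left_distributive dual_mul dual_add.
Proof. by move=> [? ?] [? ?] [? ?]; congr Dual => /=; ring. Qed.
Lemma dual_oner_neq0 : Dual 1 0 != 0 :> dual R.
Proof. by apply/eqP => -[] /eqP; rewrite oner_eq0. Qed.

HB.instance Definition _ := GRing.Zmodule_isComNzRing.Build (dual R)
  dual_mulA dual_mulC dual_mul1 dual_mulDl dual_oner_neq0.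

Definition dual_unit : {pred dual R} := fun x => dre x != 0.
(* The inverse of a non-unit x is x, as required by [unitRingType]. *)
Definition dual_inv x :=
  if dre x == 0 then x else Dual (dre x)^-1 (- deps x / dre x ^+ 2).

Lemma dual_mulVx : {in dual_unit, left_inverse 1 dual_inv *%R}.
Proof.
move=> [u v]; rewrite -topredE /dual_unit /dual_inv /= => u0.
rewrite (negPf u0).
congr Dual => /=; first by rewrite mulVf.
by rewrite expr2 invfM mulrA divfK // mulNr mulrC addrC addNr.
Qed.
Lemma dual_unitPl x y : y * x = 1 -> dual_unit x.
Proof.
case: x y => [u v] [u' v'] [] /= uu' _; rewrite /dual_unit /=.
apply: contra_eqN uu' => /eqP ->; by rewrite mulr0 eq_sym oner_eq0.
Qed.
Lemma dual_invr_out : {in [predC dual_unit], dual_inv =1 id}.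
Proof.
by move=> x; rewrite -topredE /= negbK /dual_inv => ->.
Qed.

HB.instance Definition _ := GRing.ComNzRing_hasMulInverse.Build (dual R)
  dual_mulVx dual_unitPl dual_invr_out.

End DualRing.

Section GammaBeta.
Variable R : realType.
Implicit Types (a c t x : R) (u v : dual R).

Definition nonpos_int x : bool := (x \is a Num.int) && (x <= 0).

(* Euler's integral; only used for 0 < a. *)
Definition Gamma_pos a : R :=
  \int[lebesgue_measure]_(t in `]0, +oo[) (t `^ (a - 1) * expR (- t)).

(* The number of unit steps which bring a into the half line of positive reals:
   0 if 0 < a, and the least n with 0 < a + n otherwise. *)
Definition Gamma_shift a : nat := Num.truncn (1 - a).

(* Gamma is extended from the positive reals by Gamma (a + 1) = a Gamma a;
   at 0, -1, -2, ... it has the dummy value 0. *)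
Definition Gamma a : R :=
  Gamma_pos (a + (Gamma_shift a)%:R) / \prod_(i < Gamma_shift a) (a + i%:R).

Definition rGamma a : R := if nonpos_int a then 0 else (Gamma a)^-1.

Definition beta a c : R := Gamma a * Gamma c * rGamma (a + c).

(* t ^ (a + eps b) = t ^ a (1 + eps b log t), for 0 < t. *)
Definition dual_pow t u : dual R :=
  Dual (t `^ dre u) (t `^ dre u * (deps u * ln t)).

Definition dual_integral (D : set R) (F : R -> dual R) : dual R :=
  Dual (\int[lebesgue_measure]_(t in D) dre (F t))
       (\int[lebesgue_measure]_(t in D) deps (F t)).

Definition Gammad u : dual R :=
  Dual (Gamma (dre u)) (deps u * derive1 Gamma (dre u)).

Definition betad u v : dual R :=
  if (0 < dre u) && (0 < dre v) then
    dual_integral `]0, 1[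
      (fun t => dual_pow t (u - 1) * dual_pow (1 - t) (v - 1))
  else
    Dual (beta (dre u) (dre v))
         (deps u * derive1 (fun x => beta x (dre v)) (dre u) +
          deps v * derive1 (fun x => beta (dre u) x) (dre v)).

End GammaBeta.

(* Main.v *)
Require Import Defs.
From mathcomp Require Import all_boot all_order all_algebra.
From mathcomp Require Import all_classical all_reals all_analysis.
From mathcomp Require Import measurable_realfun.
From mathcomp Require Import ring lra zify.
Set Implicit Arguments.
Unset Strict Implicit.
Unset Printing Implicit Defensive.
Import Order.TTheory GRing.Theory Num.Theory.
Import numFieldNormedType.Exports.
Local Open Scope ring_scope.
Local Open Scope classical_set_scope.

(** Write [rGammad u] for the dual extension of the entire function 1/Gamma.
    Everything rests on one product formula ([betadE]): when the real parts of
    [u] and [v] are not in {0, -1, -2, ...},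
      [betad u v = Gammad u * Gammad v * rGammad (u + v)].
    A dual extension f (a + eps b) = f a + eps b f'(a) turns functional
    equations of f into functional equations over the dual numbers, so that
    [Gammad (u + 1) = u * Gammad u], [rGammad u = u * rGammad (u + 1)] and
    [rGammad u * Gammad u = 1].  With these, the three items are identities in
    the commutative ring of dual numbers.  The factor 1/Gamma may vanish (at
    a + c in item 1, at a + c + e in item 2), which is why it is kept as a
    function of its own, differentiable also at the poles of Gamma.

    When the real parts are not both positive, the product formula is the
    Leibniz rule, once Gamma and 1/Gamma are known to be differentiable; that is
    carried from the positive half line to the left by the functional equations.
    For positive real parts it amounts to two facts about integrals.

    The first is Euler's formula Gamma(a) Gamma(c) = Gamma(a + c) B(a, c)
    ([egammaM]), obtained by Tonelli and affine changes of variables.  It is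
    stated over the extended reals, before any integral is known to converge:
    Gamma(1) = 1 and B(a, 1) = 1/a then give Gamma(a + 1) = a Gamma(a), and from
    it the finiteness of both integrals, without an integration by parts.

    The second is differentiation under the integral sign ([is_derive_mellin]).
    The Gamma integral and the Beta integral, the latter in either argument, are
    of the form x |-> int phi^(x - 1) w with phi > 0 and w >= 0.  If such a
    transform converges for all x > 0 it is differentiable there, because the
    logarithm is dominated by small powers of phi. *)

Local Notation mu := lebesgue_measure.

(** * Euler's integrals over the extended reals *)

Section EulerProduct.
Variable R : realType.
Implicit Types (a b c d r t v w x y z : R).

(** Both sides integrate [f] against the same measure, since Lebesgue measure is
    characterized by its values on half-open intervals. *)
Lemma ge0_integral_affine (f : R -> \bar R) r b : 0 < r ->
  measurable_fun [set: R] f -> (forall x, 0 <= f x)%E ->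
  (\int[mu]_x f x = r%:E * \int[mu]_x f (r * x + b)%R)%E.
Proof.
move=> r0 mf f0.
pose phi : measurableTypeR R -> measurableTypeR R := fun x => r * x + b.
have mphi : measurable_fun setT phi.
  by apply: measurable_funD => //; exact: measurable_funM.
have -> : (\int[mu]_x f (r * x + b)%R = \int[pushforward mu phi]_x f x)%E.
  by rewrite ge0_integral_pushforward.
have -> : r = (NngNum (ltW r0))%:num by [].
rewrite -ge0_integral_mscale//.
apply: eq_measure_integral => A mA _.
apply: lebesgue_measure_unique => // _ [[u v]] _ <-.
have E : phi @^-1` `]u, v] = `](u - b) / r, (v - b) / r].
  apply/seteqP; split => x /=; rewrite !in_itv/= ltr_pdivrMr// ler_pdivlMr//;
  by rewrite /phi ltrBlDr lerBrDr (mulrC x).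
change (mu `]u, v] = r%:E * mu (phi @^-1` `]u, v]))%E.
rewrite E !lebesgue_measure_itv/= !lte_fin.
rewrite ltr_pM2r ?invr_gt0// ltrD2r.
case: ifP => _; last by rewrite mule0.
by rewrite -!EFinB -EFinM; congr EFin; field; rewrite gt_eqF.
Qed.

(** The power is cut off to the positive half line, so that the Gamma and Beta
    integrands live on the whole line and changes of variables do not have to
    follow the domain of integration. *)
Definition tpow a t : R := if 0 < t then t `^ (a - 1) else 0.

Definition egamma a : \bar R := (\int[mu]_t (tpow a t * expR (- t))%:E)%E.

Definition ebeta a c : \bar R := (\int[mu]_t (tpow a t * tpow c (1 - t))%:E)%E.

Lemma tpow_ge0 a t : 0 <= tpow a t.
Proof. by rewrite /tpow; case: ifP => // _; exact: powR_ge0. Qed.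

Lemma tpow_scale a r t : 0 < r -> tpow a (r * t) = r `^ (a - 1) * tpow a t.
Proof.
move=> r0; rewrite /tpow pmulr_rgt0//; case: ifPn => t0; last by rewrite mulr0.
by rewrite powRM// ltW.
Qed.

Lemma measurable_tpow a : measurable_fun [set: R] (tpow a).
Proof.
by apply: measurable_fun_ifT => //; exact: measurable_fun_ltr.
Qed.

Lemma measurable_gamma_integrand a :
  measurable_fun [set: R] (fun t => tpow a t * expR (- t)).
Proof.
by apply: measurable_funM; [exact: measurable_tpow|exact: measurableT_comp].
Qed.

Lemma measurable_beta_integrand a c :
  measurable_fun [set: R] (fun t => tpow a t * tpow c (1 - t)).
Proof.
apply: measurable_funM; first exact: measurable_tpow.
by apply: measurableT_comp; [exact: measurable_tpow|exact: measurable_funB].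
Qed.

Lemma egamma_ge0 a : (0 <= egamma a)%E.
Proof.
by apply: integral_ge0 => t _; rewrite lee_fin mulr_ge0 ?tpow_ge0 ?expR_ge0.
Qed.

Lemma ebeta_ge0 a c : (0 <= ebeta a c)%E.
Proof. by apply: integral_ge0 => t _; rewrite lee_fin mulr_ge0 ?tpow_ge0. Qed.

(** Writing the product as a double integral and putting [s = r - t], Tonelli
    gives the integral over [r] of the convolution of the two Gamma integrands.
    By homogeneity ([tpow_scale]) the substitution [t = r * v] turns that
    convolution into the Gamma integrand of exponent [a + c] times the Beta
    integral. *)
Lemma egammaM a c : (egamma a * egamma c = egamma (a + c) * ebeta a c)%E.
Proof.
pose g x t := tpow x t * expR (- t).
have g0 x t : 0 <= g x t by rewrite mulr_ge0 ?tpow_ge0 ?expR_ge0.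
have mg x : measurable_fun [set: R] (g x) by exact: measurable_gamma_integrand.
transitivity (\int[mu]_t \int[mu]_r (g a t * g c (r - t))%:E)%E.
  rewrite -[egamma a]/(\int[mu]_t (g a t)%:E)%E -ge0_integralZr//; first last.
  - exact: egamma_ge0.
  - by move=> t _; rewrite lee_fin.
  - by apply/measurable_EFinP; exact: mg.
  apply: eq_integral => t _.
  rewrite -[egamma c]/(\int[mu]_r (g c r)%:E)%E -ge0_integralZl//; first last.
  - by rewrite lee_fin.
  - by move=> r _; rewrite lee_fin.
  - by apply/measurable_EFinP; exact: mg.
  rewrite (@ge0_integral_affine
    (fun s => ((g a t)%:E * (g c s)%:E)%E) 1 (- t))//; first last.
  - by move=> r; rewrite mule_ge0 ?lee_fin.
  - apply: emeasurable_funM; first exact: measurable_cst.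
    by apply/measurable_EFinP; exact: mg.
  by rewrite mul1e; apply: eq_integral => r _; rewrite mul1r.
rewrite (@fubini_tonelli _ _ _ _ _ mu mu
  (fun p : R * R => (g a p.1 * g c (p.2 - p.1))%:E)) //=; first last.
- by move=> p; rewrite lee_fin mulr_ge0.
- apply/measurable_EFinP; apply: measurable_funM.
    exact: measurableT_comp.
  by apply: measurableT_comp => //; exact: measurable_funB.
rewrite -[egamma _]/(\int[mu]_r (g (a + c) r)%:E)%E -ge0_integralZr//;
  first last.
- exact: ebeta_ge0.
- by move=> t _; rewrite lee_fin.
- by apply/measurable_EFinP; exact: mg.
apply: eq_integral => r _ /=.
have [r0|r0] := ltP 0 r; last first.
  rewrite integral0_eq; first by rewrite /g /tpow ltNge r0/= mul0r mul0e.
  move=> t _; rewrite /g /tpow subr_gt0.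
  case: (ltP 0 t) => t0; last by rewrite !mul0r.
  by rewrite ltNge (le_trans r0 (ltW t0))/= mul0r mulr0.
rewrite (@ge0_integral_affine (fun t => (g a t * g c (r - t))%:E) r 0)//;
  first last.
- by move=> t; rewrite lee_fin mulr_ge0.
- apply/measurable_EFinP; apply: measurable_funM; first exact: mg.
  by apply: (measurableT_comp (mg c)); exact: measurable_funB.
rewrite -ge0_integralZl//; first last.
- by rewrite lee_fin ltW.
- by move=> t _; rewrite lee_fin mulr_ge0.
- have maff : measurable_fun [set: R] (fun t => r * t + 0).
    by apply: measurable_funD => //; exact: measurable_funM.
  apply/measurable_EFinP; apply: measurable_funM.
    exact: (measurableT_comp (mg a)).
  by apply: (measurableT_comp (mg c)); exact: measurable_funB.
rewrite -ge0_integralZl//; first last.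
- by rewrite lee_fin.
- by move=> t _; rewrite lee_fin mulr_ge0 ?tpow_ge0.
- by apply/measurable_EFinP; exact: measurable_beta_integrand.
apply: eq_integral => t _; rewrite -!EFinM; congr EFin.
rewrite addr0 /g; have -> : r - r * t = r * (1 - t) by ring.
rewrite !tpow_scale//.
have -> : tpow (a + c) r = r * r `^ (a - 1) * r `^ (c - 1).
  rewrite /tpow r0; have -> : a + c - 1 = 1 + ((a - 1) + (c - 1)) by ring.
  by rewrite !powRD ?(gt_eqF r0) ?implybT// powRr1 ?ltW// mulrA.
have -> : expR (- r) = expR (- (r * t)) * expR (- (r * (1 - t))).
  by rewrite -expRD; congr expR; ring.
ring.
Qed.

End EulerProduct.

(** * Values of the Gamma integral on the half line *)

Section GammaIntegral.
Variable R : realType.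
Implicit Types (a b c d r t v w x y z : R).

Lemma ler_powR_sum t x y z : 0 < t -> y <= x -> x <= z ->
  t `^ x <= t `^ y + t `^ z.
Proof.
move=> t0 yx xz; have [t1|t1] := leP t 1.
  by rewrite (@le_trans _ _ (t `^ y)) ?lerDl ?powR_ge0// ger_powR// t0.
by rewrite (@le_trans _ _ (t `^ z)) ?lerDr ?powR_ge0// ler_powR// ltW.
Qed.

Lemma integral_expRN x :
  (\int[mu]_(t in `[x, +oo[) (expR (- t))%:E = (expR (- x))%:E)%E.
Proof.
have cN : continuous (fun t : R => expR (- t)).
  move=> t; apply: continuous_comp; first exact: continuousN.
  exact: continuous_expR.
have dN t : derivable (fun t : R => - expR (- t)) t 1 by exact: ex_derive.
rewrite (@ge0_continuous_FTC2y _ _ (fun t => - expR (- t)) _ 0).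
- by rewrite EFinN oppeK add0e.
- by move=> t _; exact: expR_ge0.
- exact: continuous_subspaceT.
- by rewrite -oppr0; apply: cvgN; exact: cvgr_expR.
- by move=> t _.
- by apply/cvg_at_right_filter; apply: cvgN; exact: cN.
- move=> t _; rewrite derive1N// derive1_comp// derive1N// derive1_id.
  have /funeqP dE := @derive_expR R.
  by rewrite derive1E dE mulrN1 opprK.
Qed.

(** Together with [integral_expRN] this bounds Gamma from below by exp(-1) on
    [1, +oo), which is how Gamma is seen not to vanish. *)
Lemma tpow_expR_ge x t : 1 <= x -> 1 <= t ->
  expR (- t) <= tpow x t * expR (- t).
Proof.
move=> x1 t1; rewrite ler_peMl ?expR_ge0// /tpow (lt_le_trans ltr01 t1).
by rewrite -[leLHS](powRr0 t) ler_powR// subr_ge0.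
Qed.

Lemma egamma1 : egamma (1 : R) = 1%E.
Proof.
have -> : 1%E = (expR (- (0 : R)))%:E :> \bar R by rewrite oppr0 expR0.
rewrite -integral_expRN -integral_itv_obnd_cbnd; last first.
  apply/measurable_EFinP/measurable_funTS.
  exact: measurableT_comp.
rewrite [RHS]integral_mkcond; apply: eq_integral => t _.
rewrite patchE /tpow subrr powRr0.
have [t0|t0] := ltP 0 t.
  by rewrite mem_set ?mul1r//= in_itv/= t0.
by rewrite memNset ?mul0r//= in_itv/= andbT; apply/negP; rewrite -leNgt.
Qed.

(** For [a < 1] the integrand is unbounded at 0, hence the exhaustion of ]0, 1]
    by the compact intervals [1/(n + 2), 1] and monotone convergence. *)
Lemma integral_powR01 a : 0 < a ->
  (\int[mu]_(t in `]0%R, 1%R]) (t `^ (a - 1))%:E = (a^-1)%:E)%E.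
Proof.
move=> a0.
(* The offset 2 keeps these intervals from degenerating at n = 0. *)
pose F n : set R := `[n.+2%:R^-1, 1].
have F01 n : 0 < n.+2%:R^-1 :> R by rewrite invr_gt0.
have -> : `]0, 1]%classic = \bigcup_n F n.
  apply/seteqP; split => t /=.
    rewrite in_itv/= => /andP[t0 t1].
    exists (Num.truncn t^-1) => //=; rewrite /F/= in_itv/= t1 andbT.
    rewrite invf_ple ?posrE// ltW//.
    by rewrite (lt_le_trans (truncnS_gt _))// ler_nat.
  move=> [n _] /=; rewrite /F/= !in_itv/= => /andP[nt ->].
  by rewrite (lt_le_trans _ nt).
have nd : nondecreasing_seq F.
  move=> m n mn; rewrite subsetEset => t.
  rewrite /F/= !in_itv/= => /andP[mt ->].
  by rewrite (le_trans _ mt)// lef_pV2 ?posrE// ler_nat !ltnS.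
have := @ge0_nondecreasing_set_cvg_integral _ (measurableTypeR R) R F
  (fun t => (t `^ (a - 1))%:E) mu nd.
move=> /(_ _ _ _)/cvg_lim <- //; first last.
- by move=> n t _; rewrite lee_fin powR_ge0.
- move=> n; apply/measurable_EFinP; apply: measurable_funTS.
  exact: measurable_powR.
- by move=> n; exact: measurable_itv.
apply/cvg_lim => //.
have E n : (\int[mu]_(t in F n) (t `^ (a - 1))%:E =
    ((1 - n.+2%:R^-1 `^ a) / a)%:E)%E.
  have n1 : n.+2%:R^-1 < 1 :> R by rewrite invf_lt1// ltr1n.
  rewrite (@continuous_FTC2 _ _ (fun t => t `^ a / a))//.
  - by rewrite -EFinB powR1 -mulrBl.
  - apply: derivable_within_continuous => t; rewrite in_itv/= => /andP[nt _].
    by apply: derivable_powR; rewrite in_itv/= andbT (lt_le_trans _ nt).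
  - have d t : 0 < t -> derivable (fun t => t `^ a / a) t 1.
      move=> t0; apply: derivableM => //; apply: derivable_powR.
      by rewrite in_itv/= andbT.
    have cd t : 0 < t -> {for t, continuous (fun t => t `^ a / a)}.
      by move=> t0; apply/differentiable_continuous/derivable1_diffP/d.
    split.
    + move=> t; rewrite in_itv/= => /andP[nt _].
      by apply: d; rewrite (lt_trans _ nt).
    + by apply/cvg_at_right_filter/cd.
    + by apply/cvg_at_left_filter/cd.
  - move=> t; rewrite in_itv/= => /andP[nt _].
    have t0 : t \in `]0, +oo[%R by rewrite in_itv/= andbT (lt_trans _ nt).
    rewrite derive1Mr; last exact: derivable_powR.
    by rewrite powR_derive1// mulrC mulKf ?gt_eqF.
under eq_fun do rewrite E.
apply: cvg_EFin; first exact: nearW.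
rewrite /comp/= -[X in _ --> X](mul1r a^-1) -[X in X * _](subr0 1).
apply: cvgMr_tmp; apply: cvgB; first exact: cvg_cst.
have /cvg_at_rightP := powR_cvg0 a0; apply; split => //.
by have := @cvg_harmonic R; rewrite -(cvg_shiftn 1%N); apply: cvg_trans;
  apply: near_eq_cvg; apply: nearW => n; rewrite /harmonic/= addn1.
Qed.

Lemma ebeta1 a : 0 < a -> ebeta a 1 = (a^-1)%:E.
Proof.
move=> a0; rewrite -integral_powR01// -integral_itv_bndo_bndc; last first.
  by apply/measurable_EFinP/measurable_funTS; exact: measurable_powR.
rewrite [RHS]integral_mkcond; apply: eq_integral => t _.
rewrite patchE /tpow subrr powRr0 subr_gt0.
case: ifPn => t0; last first.
  by rewrite mul0r memNset//= in_itv/= (negbTE t0).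
case: ifPn => t1; last first.
  by rewrite mulr0 memNset//= in_itv/= t0 (negbTE t1).
by rewrite mulr1 mem_set//= in_itv/= t0 t1.
Qed.

(** Euler's product formula at [c = 1]. *)
Lemma egammaD1 a : 0 < a -> egamma (a + 1) = (a%:E * egamma a)%E.
Proof.
move=> a0; have := egammaM a 1; rewrite egamma1 mule1 ebeta1// => ->.
by rewrite muleCA -EFinM divff ?gt_eqF// mule1.
Qed.

End GammaIntegral.

Section GammaBetaValues.
Variable R : realType.
Implicit Types (a b c d r t v w x y z : R).

(** Finiteness spreads from 1 to the positive integers by the functional
    equation, to all [x >= 1] because the power is below the sum of two powers
    with integral exponents, and finally to all [a > 0] by the functional
    equation read backwards. *)
Lemma egamma_lty a : 0 < a -> (egamma a < +oo)%E.
Proof.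
have gS n : (egamma n.+1%:R < +oo :> \bar R)%E.
  elim: n => [|n IH]; first by rewrite egamma1 ltry.
  by rewrite -natr1 egammaD1// lte_mul_pinfty ?lee_fin.
have g1 x : 1 <= x -> (egamma x < +oo)%E.
  move=> x1; pose n := Num.truncn x.
  have xn : x <= n.+1%:R by rewrite ltW// truncnS_gt.
  apply: (@le_lt_trans _ _ (egamma 1 + egamma n.+1%:R)%E); last first.
    by rewrite lte_add_pinfty// egamma1 ltry.
  rewrite /egamma -ge0_integralD//; first last.
  - by apply/measurable_EFinP; exact: measurable_gamma_integrand.
  - by move=> t _; rewrite lee_fin mulr_ge0 ?tpow_ge0 ?expR_ge0.
  - by apply/measurable_EFinP; exact: measurable_gamma_integrand.
  - by move=> t _; rewrite lee_fin mulr_ge0 ?tpow_ge0 ?expR_ge0.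
  apply: ge0_le_integral => //.
  - by move=> t _; rewrite lee_fin mulr_ge0 ?tpow_ge0 ?expR_ge0.
  - by apply/measurable_EFinP; exact: measurable_gamma_integrand.
  - apply: emeasurable_funD; apply/measurable_EFinP;
      exact: measurable_gamma_integrand.
  move=> t _; rewrite -EFinD lee_fin -mulrDl ler_wpM2r ?expR_ge0// /tpow.
  by case: ifPn => [t0|_]; [apply: ler_powR_sum; rewrite ?lerD2r|rewrite addr0].
move=> a0; have := g1 (a + 1); rewrite lerDr ltW// => /(_ isT).
rewrite egammaD1//; move: (egamma_ge0 a).
by case: (egamma a) => [r||]//; rewrite ?ltry// mulry gtr0_sg// mul1e.
Qed.

Lemma egammaE a : 0 < a -> egamma a = (Gamma_pos a)%:E.
Proof.
move=> a0; rewrite -[LHS]fineK; last first.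
  by rewrite ge0_fin_numE ?egamma_ge0 ?egamma_lty.
congr (_%:E); rewrite /Gamma_pos /Rintegral integral_mkcond.
congr fine; apply: eq_integral => t _; rewrite patchE /tpow.
have [t0|t0] := ltP 0 t; first by rewrite mem_set//= in_itv/= t0.
by rewrite memNset ?mul0r//= in_itv/= andbT; apply/negP; rewrite -leNgt.
Qed.

Lemma Gamma_posD1 a : 0 < a -> Gamma_pos (a + 1) = a * Gamma_pos a.
Proof.
by move=> a0; apply: EFin_inj; rewrite EFinM -!egammaE ?egammaD1// addr_gt0.
Qed.

(** A lower bound is at hand for [x >= 1] only; the functional equation brings
    the other arguments there. *)
Lemma Gamma_pos_gt0 a : 0 < a -> 0 < Gamma_pos a.
Proof.
have g1 x : 1 <= x -> 0 < Gamma_pos x.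
  move=> x1; have x0 : 0 < x by rewrite (lt_le_trans ltr01).
  rewrite -lte_fin -egammaE//.
  apply: (@lt_le_trans _ _ (expR (- (1 : R)))%:E).
    by rewrite lte_fin expR_gt0.
  rewrite -integral_expRN integral_mkcond; apply: ge0_le_integral => //.
  - by move=> t _; apply: erestrict_ge0 => s _; rewrite lee_fin expR_ge0.
  - apply/(measurable_restrictT _ _).1 => //; apply/measurable_EFinP.
    by apply: measurable_funTS; exact: measurableT_comp.
  - by apply/measurable_EFinP; exact: measurable_gamma_integrand.
  move=> t _; rewrite patchE; case: ifPn;
    rewrite ?lee_fin ?mulr_ge0 ?tpow_ge0 ?expR_ge0//.
  by rewrite inE/= in_itv/= andbT => t1; exact: tpow_expR_ge.
move=> a0; have := g1 (a + 1); rewrite lerDr ltW// => /(_ isT).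
by rewrite Gamma_posD1// pmulr_rgt0.
Qed.

Lemma ebetaE a c : 0 < a -> 0 < c ->
  ebeta a c = (Gamma_pos a * Gamma_pos c / Gamma_pos (a + c))%:E.
Proof.
move=> a0 c0; have ac0 : 0 < a + c by exact: addr_gt0.
have G0 := Gamma_pos_gt0 ac0.
have := egammaM a c; rewrite !egammaE//; have := ebeta_ge0 a c.
case: (ebeta a c) => // [b _|_].
  by move=> [->]; rewrite mulrC mulKf ?gt_eqF.
by rewrite mulry gtr0_sg// mul1e -EFinM.
Qed.

End GammaBetaValues.

(** * Differentiation of Mellin transforms *)

Section PowerBounds.
Variable R : realType.
Implicit Types (a b c d r t v w x y z : R).

(** From [ln z < z] at [z = y `^ d] and [z = y `^ (- d)]. *)
Lemma normr_ln_powR y d : 0 < y -> 0 < d ->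
  `|ln y| <= d^-1 * (y `^ (- d) + y `^ d).
Proof.
move=> y0 d0.
have H x : x * ln y <= y `^ x.
  by rewrite -ln_powR ltW// ln_sublinear// powR_gt0.
have H1 := H d; have H2 := H (- d).
have := powR_ge0 y d; have := powR_ge0 y (- d).
rewrite ler_pdivlMl// => P1 P2.
have -> : d * `|ln y| = `|d * ln y| by rewrite normrM gtr0_norm.
by rewrite ler_norml; apply/andP; split; lra.
Qed.

Lemma is_derive_powR_exponent y w x : 0 < y ->
  is_derive x 1 (fun x => y `^ (x - 1) * w) (y `^ (x - 1) * ln y * w).
Proof.
move=> y0.
have -> : (fun x => y `^ (x - 1) * w) = (fun x => expR ((x - 1) * ln y) * w).
  by apply/funext => z; rewrite /powR gt_eqF.
rewrite /powR gt_eqF//.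
apply: is_derive_eq.
by rewrite /GRing.scale/=; ring.
Qed.

End PowerBounds.

Section MellinTransform.
Variable R : realType.
Implicit Types (a d t x : R).
Variables (D : set R) (phi w : R -> R).
Hypothesis mD : measurable D.
Hypothesis mphi : measurable_fun D phi.
Hypothesis phi_gt0 : forall t, D t -> 0 < phi t.
Hypothesis w_ge0 : forall t, 0 <= w t.
Hypothesis mellin_integrable : forall x, 0 < x ->
  mu.-integrable D (fun t => (phi t `^ (x - 1) * w t)%:E).

(** A majorant of the derivatives in [x] of the integrand, uniform over [x] in
    ]a - d, a + d[: the logarithm costs an exponent [d], and moving [x] to [a]
    another one. *)
Let bound d a t :=
  d^-1 * (2 * (phi t `^ (a - 2 * d - 1) + phi t `^ (a + 2 * d - 1))) * w t.

Let bound_ge0 d a t : 0 < d -> 0 <= bound d a t.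
Proof.
by move=> d0; rewrite /bound !mulr_ge0 ?addr_ge0 ?powR_ge0// invr_ge0 ltW.
Qed.

Let integrable_bound d a : 0 < d -> 2 * d < a ->
  mu.-integrable D (EFin \o bound d a).
Proof.
move=> d0 da.
have -> : EFin \o bound d a = (fun t => (d^-1 * 2)%:E *
    ((phi t `^ (a - 2 * d - 1) * w t)%:E +
     (phi t `^ (a + 2 * d - 1) * w t)%:E))%E.
  by apply/funext => t; rewrite /= -EFinD -EFinM /bound; congr EFin; ring.
apply: integrableZl => //; apply: integrableD => //; apply: mellin_integrable.
  by rewrite subr_gt0.
by rewrite addr_gt0// ?mulr_gt0// (lt_trans _ da)// mulr_gt0.
Qed.

Let normr_le_bound d a x t : 0 < d -> D t -> x \in `]a - d, a + d[%R ->
  `|phi t `^ (x - 1) * ln (phi t) * w t| <= bound d a t.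
Proof.
move=> d0 /phi_gt0 t0; rewrite in_itv/= => /andP[xl xu].
rewrite normrM (ger0_norm (w_ge0 t)) ler_wpM2r//.
rewrite normrM (ger0_norm (powR_ge0 _ _)).
apply: (le_trans (ler_wpM2l (powR_ge0 _ _) (normr_ln_powR t0 d0))).
rewrite mulrCA ler_pM2l ?invr_gt0// mulrDr -!powRD ?(gt_eqF t0) ?implybT//.
rewrite mulr_natl mulr2n lerD//; apply: ler_powR_sum => //; lra.
Qed.

Let partial1_mellin x t : D t ->
  partial1of2 (fun x t => phi t `^ (x - 1) * w t) x t =
  phi t `^ (x - 1) * ln (phi t) * w t.
Proof.
move=> Dt; rewrite partial1of2E.
by have [_ ->] := is_derive_powR_exponent (w t) x (phi_gt0 Dt).
Qed.

(** The choice [d = a / 4] keeps the smallest exponent of the majorant,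
    [a - 2 * d = a / 2], in the range where the transform converges. *)
Lemma mellin_ln_integrable a : 0 < a ->
  mu.-integrable D (fun t => (phi t `^ (a - 1) * ln (phi t) * w t)%:E).
Proof.
move=> a0; have d0 : 0 < a / 4 by rewrite divr_gt0.
apply: (le_integrable _ _ _ (@integrable_bound (a / 4) a d0 _)) => //.
- apply/measurable_EFinP.
  under eq_fun do rewrite mulrAC.
  apply: measurable_funM.
    by have /integrableP[/measurable_EFinP] := mellin_integrable a0.
  by apply: measurableT_comp.
- move=> t Dt; rewrite lee_fin /= (ger0_norm (bound_ge0 _ _ d0)).
  by apply: normr_le_bound => //; rewrite in_itv/=; apply/andP; split; lra.
- by lra.
Qed.

Lemma is_derive_mellin a : 0 < a ->
  is_derive a 1 (fun x => \int[mu]_(t in D) (phi t `^ (x - 1) * w t))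
    (\int[mu]_(t in D) (phi t `^ (a - 1) * ln (phi t) * w t)).
Proof.
move=> a0; have d0 : 0 < a / 4 by rewrite divr_gt0.
pose f x t := phi t `^ (x - 1) * w t.
have Ia : `]a - a / 4, a + a / 4[%classic a.
  by rewrite /= in_itv/=; apply/andP; split; lra.
have intf x : `]a - a / 4, a + a / 4[%classic x ->
    mu.-integrable D (EFin \o f x).
  by rewrite /= in_itv/= => /andP[xl _]; apply: mellin_integrable; lra.
have derf x t : `]a - a / 4, a + a / 4[%classic x -> D t ->
    derivable (f ^~ t) x 1.
  by move=> _ Dt; have [] := is_derive_powR_exponent (w t) x (phi_gt0 Dt).
have intG : mu.-integrable D (EFin \o bound (a / 4) a).
  by apply: integrable_bound => //; lra.
have G_ub x t : `]a - a / 4, a + a / 4[%classic x -> D t ->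
    `|partial1of2 f x t| <= bound (a / 4) a t.
  by move=> Ix Dt; rewrite partial1_mellin//; exact: normr_le_bound.
split.
  exact: (@derivable_under_integral R _ (measurableTypeR R) mu f D mD _ _ _ Ia
    intf derf _ (fun t => bound_ge0 _ _ d0) intG G_ub).
rewrite -derive1E.
rewrite (@differentiation_under_integral R _ (measurableTypeR R) mu f D mD
  _ _ _ Ia intf derf _ (fun t => bound_ge0 _ _ d0) intG G_ub).
by apply: eq_Rintegral => t /set_mem Dt; rewrite partial1_mellin.
Qed.

End MellinTransform.

Section EulerDifferentiable.
Variable R : realType.
Implicit Types (a b c d r t v w x y z : R).

Lemma ge0_integrable (D : set R) (f : R -> R) : measurable D ->
  measurable_fun D f -> (forall t, 0 <= f t) ->
  (\int[mu]_(t in D) (f t)%:E < +oo)%E -> mu.-integrable D (fun t => (f t)%:E).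
Proof.
move=> mD mf f0 foo; apply/integrableP; split; first exact/measurable_EFinP.
by under eq_integral do rewrite gee0_abs ?lee_fin//.
Qed.

Lemma integrable_gamma a : 0 < a ->
  mu.-integrable `]0, +oo[ (fun t => (t `^ (a - 1) * expR (- t))%:E).
Proof.
move=> a0; apply: ge0_integrable => //.
- apply: measurable_funTS; apply: measurable_funM; first exact: measurable_powR.
  exact: measurableT_comp.
- by move=> t; rewrite mulr_ge0 ?powR_ge0 ?expR_ge0.
rewrite (_ : (\int[mu]_(t in _) _)%E = egamma a) ?egamma_lty//.
rewrite integral_mkcond; apply: eq_integral => t _; rewrite patchE /tpow.
have [t0|t0] := ltP 0 t; first by rewrite mem_set//= in_itv/= t0.
by rewrite memNset ?mul0r//= in_itv/= andbT; apply/negP; rewrite -leNgt.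
Qed.

Lemma ebeta_itv a c :
  (\int[mu]_(t in `]0%R, 1%R[) (t `^ (a - 1) * (1 - t) `^ (c - 1))%:E =
   ebeta a c)%E.
Proof.
rewrite integral_mkcond; apply: eq_integral => t _.
rewrite patchE /tpow subr_gt0.
case: ifPn => [/set_mem/=|]; first by rewrite in_itv/= => /andP[-> ->].
rewrite notin_setE/= in_itv/= => /negP; rewrite negb_and.
by case/orP => /negbTE ->; rewrite ?mul0r ?mulr0.
Qed.

Lemma integrable_beta a c : 0 < a -> 0 < c ->
  mu.-integrable `]0, 1[ (fun t => (t `^ (a - 1) * (1 - t) `^ (c - 1))%:E).
Proof.
move=> a0 c0; apply: ge0_integrable => //.
- apply: measurable_funTS; apply: measurable_funM; first exact: measurable_powR.
  apply: (measurableT_comp (measurable_powR (c - 1))).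
  exact: measurable_funB.
- by move=> t; rewrite mulr_ge0 ?powR_ge0.
by rewrite ebeta_itv ebetaE// ltry.
Qed.

Lemma integrable_beta_onem a c : 0 < a -> 0 < c ->
  mu.-integrable `]0, 1[%classic
    (fun t => ((1 - t) `^ (c - 1) * t `^ (a - 1))%:E).
Proof.
move=> a0 c0; rewrite (_ : (fun t => _) =
  (fun t => (t `^ (a - 1) * (1 - t) `^ (c - 1))%:E)).
  exact: integrable_beta.
by apply/funext => t; rewrite mulrC.
Qed.

Lemma beta_integralE a c : 0 < a -> 0 < c ->
  \int[mu]_(t in `]0, 1[) (t `^ (a - 1) * (1 - t) `^ (c - 1)) =
  Gamma_pos a * Gamma_pos c / Gamma_pos (a + c).
Proof. by move=> a0 c0; rewrite /Rintegral ebeta_itv ebetaE. Qed.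

Lemma derivable_Gamma_pos a : 0 < a -> derivable (@Gamma_pos R) a 1.
Proof.
move=> a0.
(* The Gamma integral is the transform with phi = id and w t = exp(- t). *)
have id0 t : `]0, +oo[%classic t -> 0 < idfun t by rewrite /= in_itv/= andbT.
have [] // := @is_derive_mellin R `]0, +oo[ idfun (fun t => expR (- t))
  (measurable_itv _) id0 (fun t => expR_ge0 (- t)) (@integrable_gamma) _ a0.
Qed.

End EulerDifferentiable.

(** * The Gamma function and its reciprocal on the real line *)

Section GammaShift.
Variable R : realType.
Implicit Types (a b c d r t v w x y z : R).

Lemma nonpos_int_gt0 a : 0 < a -> ~~ nonpos_int a.
Proof. by move=> a0; rewrite /nonpos_int negb_and -ltNge a0 orbT. Qed.

Lemma nonpos_int_neq0 a : ~~ nonpos_int a -> a != 0.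
Proof. by apply: contraNneq => ->; rewrite /nonpos_int rpred0 lexx. Qed.

Lemma nonpos_intD1 a : a != 0 -> nonpos_int (a + 1) = nonpos_int a.
Proof.
move=> a0; rewrite /nonpos_int rpredDr ?rpred1//.
case: (boolP (a \is a Num.int)) => //= /intrP[m am]; move: a0; rewrite am.
by rewrite -[1]/(1%:~R) -intrD intr_eq0 !lerz0 => m0; lia.
Qed.

Lemma near_neq0 a : a != 0 -> \forall x \near a, x != 0.
Proof.
move=> a0; apply: (@open_nbhs_nbhs _ a [set x | x != 0]).
by split => //; exact: open_neq.
Qed.

Lemma is_derive_derive1 (f : R -> R) a df : is_derive a 1 f df ->
  derive1 f a = df.
Proof. by move=> [_ <-]; rewrite derive1E. Qed.

Lemma is_derive_mulf (f g : R -> R) a df dg : is_derive a 1 f df ->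
  is_derive a 1 g dg ->
  is_derive a 1 (fun x => f x * g x) (df * g a + f a * dg).
Proof.
move=> fa ga; have := is_deriveM fa ga.
by rewrite /GRing.scale/= addrC (mulrC (g a)).
Qed.

Lemma derivable_mulf (f g : R -> R) a : derivable f a 1 -> derivable g a 1 ->
  derivable (fun x => f x * g x) a 1.
Proof.
by move=> /derivableP fa /derivableP ga; have [] := is_derive_mulf fa ga.
Qed.

Lemma is_derive_shift (f : R -> R) a c : derivable f (a + c) 1 ->
  is_derive a 1 (fun x => f (x + c)) (derive1 f (a + c)).
Proof.
move=> fac; have ? : is_derive (a + c) 1 f (derive1 f (a + c)).
  by apply: DeriveDef; [exact: fac|rewrite derive1E].
rewrite -[X in is_derive _ _ _ X]mulr1.
have dc : is_derive a 1 (fun x => x + c) 1.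
  by apply: is_derive_eq; rewrite addr0.
exact: (@is_derive1_comp _ f (fun x => x + c)).
Qed.

Lemma Gamma_gt0E a : 0 < a -> Gamma a = Gamma_pos a.
Proof.
move=> a0; have S0 : Gamma_shift a = 0%N.
  by apply/truncn0Pn; rewrite -ltNge gtrBl.
by rewrite /Gamma S0 big_ord0 divr1 addr0.
Qed.

Lemma GammaD1 a : a != 0 -> Gamma (a + 1) = a * Gamma a.
Proof.
move=> a_neq0.
have [a0|a0|/esym/eqP] := ltgtP 0 a; last by rewrite (negbTE a_neq0).
  by rewrite !Gamma_gt0E ?addr_gt0// Gamma_posD1.
pose n := Gamma_shift (a + 1).
have E : Gamma_shift a = n.+1.
  rewrite /n /Gamma_shift opprD addrCA subrr addr0; apply: truncn_def.
  have := @truncn_itv R (- a); rewrite oppr_ge0 ltW// => /(_ isT).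
  move=> /andP[l u]; apply/andP.
  by split; rewrite mulrSr (addrC 1 (- a)) ?lerD2r ?ltrD2r.
rewrite /Gamma E -/n big_ord_recl addr0.
have -> : \prod_(i < n) (a + (lift ord0 i)%:R) = \prod_(i < n) (a + 1 + i%:R).
  by apply: eq_bigr => i _; rewrite lift0 -natr1 (addrC i%:R) addrA.
by rewrite -natr1 (addrC n%:R) addrA invfM mulrCA mulVKf.
Qed.

End GammaShift.

Section GammaRegularity.
Variable R : realType.
Implicit Types (a b c d r t v w x y z : R).

(** The induction along which Gamma is extended to the left of 0. *)
Lemma Gamma_shift_ind (P : R -> Prop) :
  (forall a, 0 < a -> P a) ->
  (forall a, a <= 0 -> P (a + 1) -> P a) -> forall a, P a.
Proof.
move=> P0 PS a; have [n] : exists n : nat, 0 < a + n%:R.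
  by exists (Num.truncn (- a)).+1; rewrite -ltrBlDl sub0r truncnS_gt.
elim: n a => [|n IH] a; first by rewrite addr0; exact: P0.
rewrite -natr1 (addrC _ 1) addrA => /IH Pa1.
by have [/P0//|/PS] := ltP 0 a; apply.
Qed.

Lemma Gamma_neq0 a : ~~ nonpos_int a -> Gamma a != 0.
Proof.
elim/Gamma_shift_ind: a => [a a0 _|a _ IH aN].
  by rewrite Gamma_gt0E// gt_eqF// Gamma_pos_gt0.
have a0 := nonpos_int_neq0 aN; move: IH; rewrite nonpos_intD1// GammaD1//.
by move=> /(_ aN); rewrite mulf_eq0 negb_or => /andP[].
Qed.

Lemma derivable_Gamma a : ~~ nonpos_int a -> derivable (@Gamma R) a 1.
Proof.
elim/Gamma_shift_ind: a => [a a0 _|a _ IH aN].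
  have := derivable_Gamma_pos a0; apply: near_eq_derivable.
  by near=> x; rewrite Gamma_gt0E//; near: x; exact: lt_nbhsr.
have a0 := nonpos_int_neq0 aN; move: IH; rewrite nonpos_intD1// => /(_ aN) d1.
apply: (@near_eq_derivable _ _ _ (fun x => x^-1 * Gamma (x + 1))).
  have := near_neq0 a0; apply: filterS => x x0.
  by rewrite GammaD1// mulKf.
have [d2 _] := is_derive_shift d1.
have d3 := derivableV a0 (@derivable_id _ _ a 1).
exact: (derivable_mulf d3 d2).
Unshelve. all: end_near. Qed.

(** Unlike that of Gamma, this functional equation has no exceptions: both sides
    vanish at the poles of Gamma. *)
Lemma rGammaD1 a : rGamma a = a * rGamma (a + 1).
Proof.
have [->|a0] := eqVneq a 0.
  by rewrite mul0r /rGamma /nonpos_int rpred0 lexx.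
rewrite /rGamma nonpos_intD1//; case: ifPn => aN; first by rewrite mulr0.
by rewrite GammaD1// [in RHS]invfM mulVKf.
Qed.

Lemma rGammaV a : ~~ nonpos_int a -> rGamma a * Gamma a = 1.
Proof. by move=> aN; rewrite /rGamma (negbTE aN) mulVf// Gamma_neq0. Qed.

(** Away from the positive half line 1/Gamma is not treated as an inverse but as
    [x * rGamma (x + 1)], which makes sense across the poles of Gamma. *)
Lemma derivable_rGamma a : derivable (@rGamma R) a 1.
Proof.
elim/Gamma_shift_ind: a => [a a0|a _ IH].
  apply: (@near_eq_derivable _ _ _ (fun x => (Gamma x)^-1)).
    near=> x; rewrite /rGamma ifN// nonpos_int_gt0//.
    by near: x; exact: lt_nbhsr.
  apply: derivableV; first by apply/Gamma_neq0/nonpos_int_gt0.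
  exact/derivable_Gamma/nonpos_int_gt0.
rewrite (_ : @rGamma R = (fun x => x * rGamma (x + 1))); last first.
  by apply/funext => x; rewrite -rGammaD1.
have [d1 _] := is_derive_shift IH.
exact: (derivable_mulf (@derivable_id _ _ a 1) d1).
Unshelve. all: end_near. Qed.

End GammaRegularity.

Section GammaDerivatives.
Variable R : realType.
Implicit Types (a b c d r t v w x y z : R).

Lemma is_derive_Gamma a : ~~ nonpos_int a ->
  is_derive a 1 (@Gamma R) (derive1 (@Gamma R) a).
Proof.
by move=> aN; apply: DeriveDef; [exact: derivable_Gamma|rewrite derive1E].
Qed.

Lemma is_derive_rGamma a : is_derive a 1 (@rGamma R) (derive1 (@rGamma R) a).
Proof. by apply: DeriveDef; [exact: derivable_rGamma|rewrite derive1E]. Qed.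

Lemma derive1_GammaD1 a : ~~ nonpos_int a ->
  derive1 (@Gamma R) (a + 1) = Gamma a + a * derive1 (@Gamma R) a.
Proof.
move=> aN; have a0 := nonpos_int_neq0 aN.
have [_ <-] :
    is_derive a 1 (fun x => Gamma (x + 1)) (derive1 (@Gamma R) (a + 1)).
  by apply: is_derive_shift; apply: derivable_Gamma; rewrite nonpos_intD1.
rewrite -[X in X + _]mul1r.
have [_ <-] := is_derive_mulf (is_derive_id _ _) (is_derive_Gamma aN).
apply: near_eq_derive; have := near_neq0 a0.
by apply: filterS => x x0; rewrite GammaD1.
Qed.

Lemma derive1_rGammaD1 a :
  derive1 (@rGamma R) a = rGamma (a + 1) + a * derive1 (@rGamma R) (a + 1).
Proof.
have d1 := is_derive_shift (@derivable_rGamma R (a + 1)).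
have := is_derive_mulf (is_derive_id _ _) d1.
rewrite mul1r (_ : (fun x => x * rGamma (x + 1)) = @rGamma R); last first.
  by apply/funext => x; rewrite -rGammaD1.
by move=> [_ <-]; rewrite derive1E.
Qed.

End GammaDerivatives.

(** * The Beta function and its partial derivatives *)

Section BetaDerivatives.
Variable R : realType.
Implicit Types (a b c d r t v w x y z : R).

Lemma betaC a c : beta a c = beta c a.
Proof. by rewrite /beta (mulrC (Gamma a)) (addrC a). Qed.

Lemma is_derive_beta a c : ~~ nonpos_int a ->
  is_derive a 1 (fun x => beta x c)
    (Gamma c * (derive1 (@Gamma R) a * rGamma (a + c) +
                Gamma a * derive1 (@rGamma R) (a + c))).
Proof.
move=> aN; have dG := is_derive_Gamma aN.
have dr := is_derive_shift (@derivable_rGamma R (a + c)).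
have := is_derive_mulf (is_derive_cst (Gamma c) _ _) (is_derive_mulf dG dr).
rewrite mul0r add0r (_ : (fun x => _) = (fun x => beta x c))//.
by apply/funext => x; rewrite /beta mulrCA mulrA.
Qed.

Lemma beta_gt0E a c : 0 < a -> 0 < c -> beta a c =
  \int[mu]_(t in `]0, 1[) (t `^ (a - 1) * (1 - t) `^ (c - 1)).
Proof.
move=> a0 c0; have ac0 : 0 < a + c by exact: addr_gt0.
rewrite beta_integralE// /beta /rGamma ifN ?nonpos_int_gt0//.
by rewrite !Gamma_gt0E.
Qed.

(** Here [phi] is the identity and the weight is the power of [1 - t]; in
    [derive1_beta_gt0r] the two exchange their roles. *)
Lemma derive1_beta_gt0l a c : 0 < a -> 0 < c ->
  derive1 (fun x => beta x c) a =
  \int[mu]_(t in `]0, 1[) (t `^ (a - 1) * ln t * (1 - t) `^ (c - 1)).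
Proof.
move=> a0 c0; rewrite derive1E.
have id0 t : `]0, 1[%classic t -> 0 < idfun t by rewrite /= in_itv/= => /andP[].
have [_ <-] := @is_derive_mellin R `]0, 1[ idfun (fun t => (1 - t) `^ (c - 1))
  (measurable_itv _) id0 (fun t => powR_ge0 _ _)
  (fun x hx => integrable_beta hx c0) _ a0.
apply: near_eq_derive; near=> x.
have x0 : 0 < x by near: x; exact: lt_nbhsr.
by rewrite (beta_gt0E x0 c0); exact: eq_Rintegral.
Unshelve. all: end_near. Qed.

Lemma derive1_beta_gt0r a c : 0 < a -> 0 < c ->
  derive1 (fun x => beta a x) c =
  \int[mu]_(t in `]0, 1[) ((1 - t) `^ (c - 1) * ln (1 - t) * t `^ (a - 1)).
Proof.
move=> a0 c0; rewrite derive1E.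
have phi0 t : `]0, 1[%classic t -> 0 < 1 - t.
  by rewrite /= in_itv/= subr_gt0 => /andP[].
have intf x : 0 < x -> mu.-integrable `]0, 1[%classic
    (fun t => ((1 - t) `^ (x - 1) * t `^ (a - 1))%:E).
  exact: integrable_beta_onem.
have [_ <-] := @is_derive_mellin R `]0, 1[
  (fun t => 1 - t) (fun t => t `^ (a - 1)) (measurable_itv _)
  phi0 (fun t => powR_ge0 _ _) intf _ c0.
apply: near_eq_derive; near=> x.
have x0 : 0 < x by near: x; exact: lt_nbhsr.
by rewrite (beta_gt0E a0 x0); apply: eq_Rintegral => t _; rewrite mulrC.
Unshelve. all: end_near. Qed.

End BetaDerivatives.

(** * Dual Gamma and Beta functions *)

Section DualGammaBeta.
Variable R : realType.

Lemma dreD (u1 u2 : dual R) : dre (u1 + u2) = dre u1 + dre u2.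
Proof. by []. Qed.

Lemma dual_unitE (u : dual R) : (u \is a GRing.unit) = (dre u != 0).
Proof. by []. Qed.

Definition rGammad (u : dual R) : dual R :=
  Dual (rGamma (dre u)) (deps u * derive1 (@rGamma R) (dre u)).

Lemma GammadD1 (u : dual R) : ~~ nonpos_int (dre u) ->
  Gammad (u + 1) = u * Gammad u.
Proof.
move=> uN; have u0 := nonpos_int_neq0 uN.
congr Dual => /=; first exact: GammaD1.
by rewrite addr0 derive1_GammaD1//; ring.
Qed.

Lemma rGammadD1 (u : dual R) : rGammad u = u * rGammad (u + 1).
Proof.
congr Dual => /=; first exact: rGammaD1.
by rewrite addr0 derive1_rGammaD1; ring.
Qed.

(** The shift [u -> u + 1] leaves the product unchanged, as [u] moves from one
    factor to the other.  So the real part may be assumed positive, where the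
    derivative of the constant function [rGamma * Gamma] vanishes. *)
Lemma rGammadV (u : dual R) : ~~ nonpos_int (dre u) -> rGammad u * Gammad u = 1.
Proof.
move: {2}(dre u) (erefl (dre u)) => a.
elim/Gamma_shift_ind: a u => [a a0|a _ IH] u ua.
  rewrite ua => aN; congr Dual; rewrite /= ua; first exact: rGammaV.
  have E0 : 'D_1 (fun x => rGamma x * Gamma x) a = 0.
    rewrite -(derive_cst (1 : R) a (1 : R)); apply: near_eq_derive; near=> x.
    by rewrite /= rGammaV// nonpos_int_gt0//; near: x; exact: lt_nbhsr.
  have [_] := is_derive_mulf (is_derive_rGamma a) (is_derive_Gamma aN).
  rewrite E0 => E.
  by rewrite mulrCA -[X in _ + X]mulrA -mulrDr [X in _ * X]addrC -E mulr0.
move=> uN; rewrite rGammadD1 mulrAC -GammadD1// mulrC; apply: IH.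
  by rewrite dreD ua.
by rewrite dreD nonpos_intD1// nonpos_int_neq0.
Unshelve. all: end_near. Qed.

Lemma beta_dual_prodE (u v : dual R) :
  ~~ nonpos_int (dre u) -> ~~ nonpos_int (dre v) ->
  Dual (beta (dre u) (dre v))
       (deps u * derive1 (fun x => beta x (dre v)) (dre u) +
        deps v * derive1 (fun x => beta (dre u) x) (dre v)) =
  Gammad u * Gammad v * rGammad (u + v).
Proof.
move=> uN vN; congr Dual => //=.
have -> : (fun x => beta (dre u) x) = (fun x => beta x (dre u)).
  by apply/funext => x; rewrite betaC.
rewrite (is_derive_derive1 (is_derive_beta (dre v) uN)).
rewrite (is_derive_derive1 (is_derive_beta (dre u) vN)).
by rewrite (addrC (dre v)); ring.
Qed.

(** For positive real parts the dual part of the integral is a combination of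
    the two logarithmic integrals, which are the partial derivatives of Beta. *)
Lemma betadE (u v : dual R) :
  ~~ nonpos_int (dre u) -> ~~ nonpos_int (dre v) ->
  betad u v = Gammad u * Gammad v * rGammad (u + v).
Proof.
move=> uN vN; rewrite -beta_dual_prodE// /betad; case: ifPn => // /andP[u0 v0].
congr Dual; first by rewrite beta_gt0E.
rewrite derive1_beta_gt0l// derive1_beta_gt0r//.
have intl : mu.-integrable `]0, 1[%classic
    (fun t => (t `^ (dre u - 1) * ln t * (1 - t) `^ (dre v - 1))%:E).
  apply: (@mellin_ln_integrable R _ idfun) => //.
  - exact: measurable_id.
  - by move=> t; rewrite /= in_itv/= => /andP[].
  - by move=> t; exact: powR_ge0.
  - by move=> x x0; exact: integrable_beta.
have intr : mu.-integrable `]0, 1[%classic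
    (fun t => ((1 - t) `^ (dre v - 1) * ln (1 - t) * t `^ (dre u - 1))%:E).
  apply: (@mellin_ln_integrable R _ (fun t => 1 - t)) => //.
  - by apply: measurable_funTS; exact: measurable_funB.
  - by move=> t; rewrite /= in_itv/= subr_gt0 => /andP[].
  - by move=> t; exact: powR_ge0.
  - by move=> x x0; exact: integrable_beta_onem.
rewrite -!RintegralZl// -RintegralD//; last 2 first.
- have := @integrableZl _ (measurableTypeR R) R mu _
    (measurable_itv _) (deps u) _ intl.
  exact.
- have := @integrableZl _ (measurableTypeR R) R mu _
    (measurable_itv _) (deps v) _ intr.
  exact.
by apply: eq_Rintegral => t _ /=; rewrite !oppr0 !addr0; ring.
Qed.

Lemma rGammad_inv (u : dual R) : ~~ nonpos_int (dre u) ->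
  rGammad u = (Gammad u)^-1.
Proof. by move=> uN; apply/esym/mulr1_eq; rewrite mulrC rGammadV. Qed.

Lemma betad_mul_betad (u v w : dual R) :
  ~~ nonpos_int (dre u) -> ~~ nonpos_int (dre v) -> ~~ nonpos_int (dre w) ->
  ~~ nonpos_int (dre (u + v)) ->
  betad u v * betad (u + v) w =
  Gammad u * Gammad v * Gammad w * rGammad (u + v + w).
Proof.
move=> uN vN wN uvN; rewrite !betadE// -!mulrA; congr (_ * (_ * _)).
by rewrite mulrA rGammadV// mul1r.
Qed.

End DualGammaBeta.

Theorem theorem5p1 (R : realType) (a c e g : dual R) :
  (~~ nonpos_int (dre a) -> ~~ nonpos_int (dre (c + 1)) ->
   ~~ nonpos_int (dre (a + 1)) -> ~~ nonpos_int (dre c) ->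
   dre (a + c) != 0 ->
     betad a (c + 1) = c / a * betad (a + 1) c /\
     c / a * betad (a + 1) c = c / (a + c) * betad a c) /\
  (~~ nonpos_int (dre a) -> ~~ nonpos_int (dre c) -> ~~ nonpos_int (dre e) ->
   ~~ nonpos_int (dre (a + c)) -> ~~ nonpos_int (dre (c + e)) ->
   ~~ nonpos_int (dre (a + e)) ->
     betad a c * betad (a + c) e = betad c e * betad (c + e) a /\
     betad c e * betad (c + e) a = betad e a * betad (a + e) c) /\
  (~~ nonpos_int (dre a) -> ~~ nonpos_int (dre c) -> ~~ nonpos_int (dre e) ->
   ~~ nonpos_int (dre g) -> ~~ nonpos_int (dre (a + c)) ->
   ~~ nonpos_int (dre (a + c + e)) -> ~~ nonpos_int (dre (a + c + e + g)) ->
     betad a c * betad (a + c) e * betad (a + c + e) g =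
     Gammad a * Gammad c * Gammad e * Gammad g / Gammad (a + c + e + g)).
Proof.
split; [|split].
- move=> aN c1N a1N cN ac0.
  have a_unit : a \is a GRing.unit by rewrite dual_unitE nonpos_int_neq0.
  have ac_unit : a + c \is a GRing.unit by rewrite dual_unitE.
  have -> : betad a (c + 1) = c * (Gammad a * Gammad c * rGammad (a + c + 1)).
    by rewrite betadE// GammadD1// addrA; ring.
  have -> : c / a * betad (a + 1) c =
      c * (Gammad a * Gammad c * rGammad (a + c + 1)).
    have -> : betad (a + 1) c = a * (Gammad a * Gammad c * rGammad (a + c + 1)).
      by rewrite betadE// GammadD1// (addrAC a 1 c); ring.
    by rewrite [c / _ * _]mulrA divrK.
  have -> : betad a c = (a + c) * (Gammad a * Gammad c * rGammad (a + c + 1)).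
    by rewrite betadE// (rGammadD1 (a + c)); ring.
  by split=> //; rewrite [RHS]mulrA divrK.
- move=> aN cN eN acN ceN aeN.
  rewrite !betad_mul_betad//.
  rewrite (addrC a e) betad_mul_betad//; last by rewrite addrC.
  have -> : c + e + a = a + c + e by rewrite addrC addrA.
  have -> : e + a + c = a + c + e by rewrite -addrA addrC.
  by split; ring.
- move=> aN cN eN gN acN aceN acegN.
  rewrite betad_mul_betad// betadE// -rGammad_inv//.
  rewrite -!mulrA; congr (_ * (_ * (_ * _))).
  by rewrite mulrA rGammadV// mul1r.
Qed.
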